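(* Consider the DP-2ERM estimator $\theta^{\mathrm{priv}}=\theta^{\mathrm{priv}}(\mathcal D,\mathbf b)$ and the non-private optimal parameter $\theta^{\mathrm{opt}}=\theta^{\mathrm{opt}}(\mathcal D)$ defined in the context, for a size-$n$ dataset $\mathcal D$ with non-private optimal weights $\mathbf w=\mathbf w(\mathcal D)$. Suppose there exist $\lambda,\zeta$ such that $\mathrm{tr}(\nabla^2_\theta\ell(\theta;\mathbf d))\le\lambda$ and $\|\nabla_\theta\ell(\theta;\mathbf d)\|_2\le\zeta$ for all $\theta\in\Theta$ and all feasible records $\mathbf d$, and that the second-stage objective $\mathcal L(\cdot;\mathcal D)$ is $\rho$-strongly convex for some $\rho\ge0$ (allowing $\rho=0$). Suppose $\overline W_1,\overline W_2=O(\sqrt n)$, and calibrate $(\beta,\sigma,\gamma)$ according to the following sufficient conditions for privacy, so that $\theta^{\mathrm{priv}}$ is an $\varepsilon$-DP (respectively, $(\varepsilon,\delta)$-DP) estimator of $\theta^{\mathrm{opt}}$ with the Gamma (respectively, Gaussian) noise: - Gamma noise (density of $\mathbf b$ at $\mathbf x\in\mathbb R^p$ proportional to $\exp(-\beta\|\mathbf x\|_2)$): $$\frac1\beta\ge\frac{2\zeta}{\varepsilon}\overline W_1\quad\text{and}\quad\gamma\ge\frac{2\lambda}{\varepsilon n}\overline W_2;$$ - Gaussian noise ($\mathbf b\sim\mathcal N(\mathbf 0,\sigma^2\mathbf I_p)$): $$\sigma\ge\frac\zeta\varepsilon\left(\tilde L+\sqrt{\tilde L^2+\frac{\varepsilon}{\overline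 W_1}}\right)\overline W_1\quad\text{and}\quad\gamma\ge\frac{2\lambda}{\varepsilon n}\overline W_2,$$ where $\tilde L:=\sqrt{(\sqrt p+\sqrt{\log\delta^{-1}})^2+\log\delta^{-1}}$. Then the following holds for both the Gamma and the Gaussian noise distributions. (i) Intrinsic strong convexity ($\rho>0$): if the second-stage objective $\mathcal L$ is already $\rho$-strongly convex, then $$\mathcal L(\theta^{\mathrm{priv}};\mathcal D)-\mathcal L(\theta^{\mathrm{opt}};\mathcal D)=O_{\mathbb P}(n^{-1})\quad\text{and}\quad\|\theta^{\mathrm{priv}}-\theta^{\mathrm{opt}}\|_2=O_{\mathbb P}(n^{-1/2}).$$ (ii) No intrinsic strong convexity ($\rho=0$): if curvature is supplied only through the added regularization $\gamma$, then $$\mathcal L(\theta^{\mathrm{priv}};\mathcal D)-\mathcal L(\theta^{\mathrm{opt}};\mathcal D)=O_{\mathbb P}(n^{-1/2}).$$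
   Context: Notation: $a\wedge b=\min\{a,b\}$; $\|\mathbf v\|_0$ is the number of nonzero coordinates of $\mathbf v$; $\Delta^n$ is the $n$-dimensional probability simplex, so $n\Delta^n$ is the set of nonnegative weight vectors with total sum $n$. $O_{\mathbb P}$ denotes stochastic order as $n\to\infty$; the randomness in $\theta^{\mathrm{priv}}$ given the data comes from the noise $\mathbf b$. Differential privacy: a randomized mechanism $\mathcal M$ is $(\varepsilon,\delta)$-DP if $\mathbb P(\mathcal M(\mathcal D)\in S)\le e^\varepsilon\,\mathbb P(\mathcal M(\mathcal D')\in S)+\delta$ for any two datasets $\mathcal D,\mathcal D'$ of the same size $n$ that differ in exactly one entry and any measurable subset $S$ of the output space; $\varepsilon$-DP means $(\varepsilon,0)$-DP. Two-stage empirical risk minimization (2ERM). A size-$n$ dataset is $\mathcal D=(\mathbf d_1,\dots,\mathbf d_n)$. First stage: the weights are $\mathbf w(\mathcal D)=(w_1,\dots,w_n)=F(\boldsymbol\lambda^*(\mathcal D))\in n\Delta^n$, where $F:\Xi\to n\Delta^n$ is a fixed map, $\Xi$ is a closed convex parameter space, and $\boldsymbol\lambda^*(\mathcal D)=\arg\min_{\boldsymbol\lambda\in\Xi}\mathcal E(\boldsymbol\lambda;\mathcal D)$ for a convex loss $\mathcal E(\cdot;\mathcal D)$ depending on the data. Second stage: $\Theta\subseteq\mathbb R^p$ is a closed convex constraint set, $R$ is a convex regularizer, $\theta\mapsto\ell(\theta;\mathbf d)$ is a convex per-sample loss with continuous Hessian, $$\mathcal L(\theta;\mathcal D)=\frac1n\sum_{i=1}^n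 w_i\,\ell(\theta;\mathbf d_i)+R(\theta),\qquad\theta^{\mathrm{opt}}(\mathcal D)=\arg\min_{\theta\in\Theta}\mathcal L(\theta;\mathcal D).$$ The DP-2ERM algorithm computes the weights $\mathbf w(\mathcal D)$ non-privately, draws a noise vector $\mathbf b\in\mathbb R^p$ (Gamma noise when $\varepsilon$-DP is required, Gaussian noise when $(\varepsilon,\delta)$-DP is required), and outputs $$\theta^{\mathrm{priv}}(\mathcal D,\mathbf b)=\arg\min_{\theta\in\Theta}\Big[\mathcal L(\theta;\mathcal D)+\frac\gamma2\|\theta\|_2^2+\frac{\langle\mathbf b,\theta\rangle}{n}\Big],$$ where $\gamma$ is a regularization parameter. Weight sensitivities: for size-$n$ datasets $\mathcal D,\mathcal D'$ that differ by at most one point, with $\mathbf w=\mathbf w(\mathcal D)$ and $\mathbf w'=\mathbf w(\mathcal D')$, $$W_1(\mathcal D,\mathcal D')=\|\mathbf w-\mathbf w'\|_1+2\max_{1\le i\le n}(w_i\wedge w_i'),$$ $$W_2(\mathcal D,\mathcal D')=\sqrt{\Big(\|\mathbf w-\mathbf w'\|_2^2+2\max_{1\le i\le n}w_iw_i'\Big)\big(1+\|\mathbf w-\mathbf w'\|_0\big)},$$ and $\overline W_j$ ($j=1,2$) is the supremum of $W_j(\mathcal D,\mathcal D')$ over all size-$n$ datasets $\mathcal D,\mathcal D'$ that differ by at most one point. Asymptotic convention: all hyperparameters, such as $p,\lambda,\zeta$, are assumed fixed while the size $n$ of the datasets grows to infinity.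
   Formalization: The noise scale and γ are taken to exceed their privacy lower bounds by at most a constant factor (else noise is arbitrary), and (ii) assumes γ > 0 and θ^opt bounded as n grows; without boundedness a Huber loss with all records equal to m_n ≫ n refutes (ii). *)

(* Defs.v *)
From HB Require Import structures.
From mathcomp Require Import all_boot all_order all_algebra.
From mathcomp Require Import all_classical all_reals all_analysis.
Import Order.TTheory GRing.Theory Num.Theory.
Import numFieldNormedType.Exports.

Set Implicit Arguments.
Unset Strict Implicit.
Unset Printing Implicit Defensive.

Local Open Scope classical_set_scope.
Local Open Scope ring_scope.

Section Vectors.
Context {R : realType}.

(* The library norm on 'rV[R]_n is the sup norm, hence the definitions below. *)
Definition dotv n (u v : 'rV[R]_n) : R := \sum_i u 0 i * v 0 i.
Definition norm0 n (v : 'rV[R]_n) : nat := #|[pred i | v 0 i != 0]|.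
Definition norm1 n (v : 'rV[R]_n) : R := \sum_i `|v 0 i|.
Definition norm2 n (v : 'rV[R]_n) : R := Num.sqrt (\sum_i v 0 i ^+ 2).

Definition scaled_simplex n : set 'rV[R]_n :=
  [set w | (forall i, 0 <= w 0 i) /\ \sum_i w 0 i = n%:R].

End Vectors.

Section ConvexOptimization.
Context {R : realType}.

Definition is_argmin (T : Type) (S : set T) (f : T -> R) (x : T) : Prop :=
  S x /\ forall y, S y -> f x <= f y.

Definition strongly_convex p (rho : R) (S : set 'rV[R]_p) (f : 'rV[R]_p -> R) :=
  forall x y (t : R), S x -> S y -> 0 <= t <= 1 ->
    f (t *: x + (1 - t) *: y) <=
    t * f x + (1 - t) * f y - rho / 2 * (t * (1 - t)) * norm2 (x - y) ^+ 2.

Definition gradient p (f : 'rV[R]_p -> R) (x : 'rV[R]_p) : 'rV[R]_p :=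
  \row_i 'D_(delta_mx 0 i) f x.

Definition hessian p (f : 'rV[R]_p -> R) (x : 'rV[R]_p) : 'M[R]_p :=
  'J (gradient f) x.

Definition continuous_hessian p (f : 'rV[R]_p -> R) : Prop :=
  [/\ forall x, differentiable f x,
      forall x, differentiable (gradient f) x &
      continuous (hessian f)].

End ConvexOptimization.

Section TwoStageERM.
Context {R : realType} {X : Type}.

Definition dataset n := 'I_n -> X.

Definition adjacent n (D D' : dataset n) : Prop :=
  exists i, forall j, j != i -> D j = D' j.

Definition loss2 n p (w : 'rV[R]_n) (ell : 'rV[R]_p -> X -> R)
    (reg : 'rV[R]_p -> R) (D : dataset n) (theta : 'rV[R]_p) : R :=
  n%:R^-1 * \sum_i w 0 i * ell theta (D i) + reg theta.

Definition private_loss2 n p (w : 'rV[R]_n) (ell : 'rV[R]_p -> X -> R)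
    (reg : 'rV[R]_p -> R) (gamma : R) (b : 'rV[R]_p) (D : dataset n)
    (theta : 'rV[R]_p) : R :=
  loss2 w ell reg D theta + gamma / 2 * norm2 theta ^+ 2
    + dotv b theta / n%:R.

(* Weights are nonnegative, so 0 is a neutral default for the maxima. *)
Definition W1 n (w w' : 'rV[R]_n) : R :=
  norm1 (w - w') + 2 * \big[Num.max/0]_i Num.min (w 0 i) (w' 0 i).

Definition W2 n (w w' : 'rV[R]_n) : R :=
  Num.sqrt ((norm2 (w - w') ^+ 2 + 2 * \big[Num.max/0]_i (w 0 i * w' 0 i))
            * (1 + norm0 (w - w'))%:R).

Definition Wbar n (W : 'rV[R]_n -> 'rV[R]_n -> R) (w : dataset n -> 'rV[R]_n)
    : \bar R :=
  ereal_sup [set r | exists D D',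
    adjacent D D' /\ r = (W (w D) (w D'))%:E].

Definition Ltilde p (delta : R) : R :=
  Num.sqrt ((Num.sqrt p%:R + Num.sqrt (ln delta^-1)) ^+ 2 + ln delta^-1).

End TwoStageERM.

Section Noise.
Context {R : realType} {d : measure_display} {T : measurableType d}.

Definition vec_of_tuple p (t : p.-tuple R) : 'rV[R]_p := \row_i tnth t i.

(* Iterated Lebesgue integral over R^p; by Tonelli it is the integral against
   p-dimensional Lebesgue measure when f is measurable and nonnegative. *)
Fixpoint integral_Rp (p : nat) : (p.-tuple R -> \bar R) -> \bar R :=
  match p return (p.-tuple R -> \bar R) -> \bar R with
  | 0 => fun f => f [tuple]
  | q.+1 => fun f =>
      (\int[lebesgue_measure]_x integral_Rp (fun t => f [tuple of x :: t]))%E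
  end.

Definition gamma_noise (P : probability T R) p (beta : R)
    (b : {RV P >-> p.-tuple R}) : Prop :=
  exists c : R, forall A : set (p.-tuple R), measurable A ->
    P (b @^-1` A) = integral_Rp (fun x =>
      (\1_A x * (c * expR (- (beta * norm2 (vec_of_tuple x)))))%:E).

(* N(0, sigma^2 I_p): independent N(0, sigma^2) coordinates. *)
Definition gaussian_noise (P : probability T R) p (sigma : R)
    (b : {RV P >-> p.-tuple R}) : Prop :=
  forall A : 'I_p -> set R, (forall i, measurable (A i)) ->
    P (b @^-1` [set x | forall i, A i (tnth x i)]) =
    (\prod_(i < p) normal_prob 0 sigma (A i))%E.

(* X_n = O_P(r_n), with outer probability in place of probability: the event
   {|X_n| > M r_n} is covered by a measurable event of probability <= eta. The
   two coincide for measurable X_n; no measurability of X_n is presupposed. *)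
Definition stochastic_O (P : probability T R) (X : nat -> T -> R) (r : nat -> R) :=
  forall eta : R, 0 < eta -> exists M : R, \forall n \near \oo,
    exists A : set T, [/\ measurable A,
      [set omega | M * r n < `|X n omega|] `<=` A & (P A <= eta%:E)%E].

End Noise.

Section Calibration.
Context {R : realType}.

Definition bigO_sqrt (u : nat -> \bar R) : Prop :=
  exists C : R, \forall n \near \oo, (u n <= (C * Num.sqrt n%:R)%:E)%E.

(* The parameter x_n meets its sufficient condition x_n >= lower_n and exceeds
   it by at most a constant factor. The lower bound alone would allow
   arbitrarily large noise or regularization, hence no rate. *)
Definition calibrated (lower x : nat -> R) : Prop :=
  exists2 C : R, 0 < C & \forall n \near \oo, lower n <= x n <= C * lower n.

End Calibration.

(* Main.v *)
(* Comparing theta_priv with theta_opt in the private objective gives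
     excess <= gamma / 2 (|theta_opt|^2 - |theta_priv|^2)
               + <b, theta_opt - theta_priv> / n,
   and |b| = O_P(s), where s = 1 / beta or sigma satisfies s^2 = O(W1^2 + W1); in
   particular |b| / n and gamma are of order n^(-1/2).

   If rho > 0, theta_opt stays bounded, because the gradients of ell are bounded
   and a finite convex reg decreases at most linearly; comparing the inequality
   with the quadratic growth rho / 4 |theta_priv - theta_opt|^2 <= excess gives
   both rates.

   If rho = 0, Young's inequality absorbs |theta_priv| and leaves the term
   |b|^2 / (2 gamma n^2). It is of order n^(-1/2) even when gamma is much smaller
   than n^(-1/2), since W1 <= 3 W2 makes the noise correspondingly smaller.

   For Gamma noise, the dilation x -> 2x shows that halving beta multiplies the
   total mass by 2^p, hence P(|b| > t) <= 2^p exp(- beta t / 2). *)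
Require Import Defs.
From HB Require Import structures.
From mathcomp Require Import all_boot all_order all_algebra.
From mathcomp Require Import ring lra.
From mathcomp Require Import all_classical all_reals all_analysis.
From mathcomp Require Import measurable_realfun.
Import Order.TTheory GRing.Theory Num.Theory.
Import numFieldNormedType.Exports.

Set Implicit Arguments.
Unset Strict Implicit.
Unset Printing Implicit Defensive.

Local Open Scope classical_set_scope.
Local Open Scope ring_scope.

(** * Iterated Lebesgue integrals over R^p *)

Section IteratedIntegral.
Context {R : realType}.
Local Notation mu := (@lebesgue_measure R).
Local Open Scope ereal_scope.

Let measurable_scale (k : R) : measurable_fun [set: measurableTypeR R]
  (( *%R k) : measurableTypeR R -> measurableTypeR R).
Proof. exact: mulrl_measurable. Qed.

Let scaled_lebesgue (k : R) (k0 : (0 <= k)%R) :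
    {measure set (measurableTypeR R) -> \bar R} :=
  mscale (NngNum k0)
    (measure_function_pushforward__canonical__measure_function_Measure mu
       (measurable_scale k)).

(** Half-open intervals determine Lebesgue measure: the preimage of ]a, b] under x -> kx has length
    (b - a) / k, and the factor k restores b - a. *)
Let scaled_lebesgueE (k : R) (k0 : (0 < k)%R) A : measurable A ->
  mu A = scaled_lebesgue (ltW k0) A.
Proof.
move=> mA; apply: lebesgue_measure_unique => // _ [[a b]] _ <-.
rewrite /scaled_lebesgue/= /mscale/= /pushforward/=.
rewrite (_ : _ @^-1` _ = `](a / k)%R, (b / k)%R]%classic); last first.
  by apply/seteqP; split => x /=;
    rewrite !in_itv/= ltr_pdivrMr// ler_pdivlMr// mulrC.
rewrite !lebesgue_measure_itv/= !lte_fin ltr_pM2r ?invr_gt0//.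
case: ifPn => _; last by rewrite mule0.
by rewrite -!EFinB -EFinM -mulrBl mulrCA divff ?mulr1 ?gt_eqF.
Qed.

Lemma ge0_integral_scale (k : R) (f : R -> \bar R) : (0 < k)%R ->
  measurable_fun [set: R] f -> (forall x, 0 <= f x) ->
  \int[mu]_x f x = k%:E * \int[mu]_x f (k * x)%R.
Proof.
move=> k0 mf f0.
transitivity (\int[scaled_lebesgue (ltW k0)]_x f x).
  by apply: eq_measure_integral => A mA _; exact: scaled_lebesgueE.
rewrite ge0_integral_mscale//; congr (_ * _).
by rewrite ge0_integral_pushforward.
Qed.

Lemma integral_RpS p (f : p.+1.-tuple R -> \bar R) :
  integral_Rp f = \int[mu]_x integral_Rp (fun t => f [tuple of x :: t]).
Proof. by []. Qed.

Lemma integral_Rp_ge0 p (f : p.-tuple R -> \bar R) :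
  (forall x, 0 <= f x) -> 0 <= integral_Rp f.
Proof.
elim: p f => [|p IH] f f0 /=; first exact: f0.
by apply: integral_ge0 => x _; apply: IH => t; exact: f0.
Qed.

(** The opposite function is nonnegative, and the sign passes through each integral. This later
    excludes a negative constant in [gamma_noise]. *)
Lemma integral_Rp_le0 p (f : p.-tuple R -> \bar R) :
  (forall x, f x <= 0) -> integral_Rp f <= 0.
Proof.
elim: p f => [|p IH] f f0 /=; first exact: f0.
have g0 x : 0 <= - integral_Rp (fun t => f [tuple of x :: t]).
  by rewrite oppe_ge0; exact: IH.
under eq_integral do rewrite -[integral_Rp _]oppeK.
by rewrite integral_ge0N// oppe_le0; exact: integral_ge0.
Qed.

(** The parameter space [A] is arbitrary so that the induction can move the first coordinate into
    it; Tonelli then integrates that coordinate out. *)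
Lemma measurable_integral_Rp d (A : measurableType d) p
    (f : A -> p.-tuple R -> \bar R) :
  measurable_fun [set: A * p.-tuple R] (fun z => f z.1 z.2) ->
  (forall a x, 0 <= f a x) ->
  measurable_fun [set: A] (fun a => integral_Rp (f a)).
Proof.
elim: p d A f => [|p IH] d A f mf f0 /=.
  apply: (measurableT_comp mf (g := fun a => (a, [tuple of [::]]))).
  by apply: measurable_fun_pair; [exact: measurable_id|exact: measurable_cst].
pose g (z : A * measurableTypeR R) := integral_Rp (fun t => f z.1 [tuple of z.2 :: t]).
have mg : measurable_fun setT g.
  apply: (IH _ (A * measurableTypeR R)%type
    (fun z t => f z.1 [tuple of z.2 :: t])) => //.
  apply: (measurableT_comp mf
   (g := fun z : (A * measurableTypeR R) * p.-tuple R => (z.1.1, [tuple of z.1.2 :: z.2]))).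
  apply: measurable_fun_pair.
    exact: measurableT_comp.
  apply: measurable_cons => //.
  exact: measurableT_comp.
apply: (@measurable_fun_fubini_tonelli_F _ _ A (measurableTypeR R) R mu g mg).
by move=> z; exact: integral_Rp_ge0.
Qed.

Lemma measurable_integral_Rp_cons p (f : p.+1.-tuple R -> \bar R) :
  measurable_fun setT f -> (forall x, 0 <= f x) ->
  measurable_fun [set: R] (fun x => integral_Rp (fun t => f [tuple of x :: t])).
Proof.
move=> mf f0.
apply: (@measurable_integral_Rp _ (measurableTypeR R) _
  (fun x t => f [tuple of x :: t])) => //.
apply: (measurableT_comp mf
  (g := fun z : measurableTypeR R * p.-tuple R => [tuple of z.1 :: z.2])).
exact: measurable_cons.
Qed.

Lemma measurable_cons_slice p (f : p.+1.-tuple R -> \bar R) (x : R) :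
  measurable_fun setT f ->
  measurable_fun setT (fun t : p.-tuple R => f [tuple of x :: t]).
Proof.
move=> mf; apply: (measurableT_comp mf (g := fun t : p.-tuple R => [tuple of x :: t])).
exact: measurable_cons.
Qed.

Lemma le_integral_Rp p (f g : p.-tuple R -> \bar R) :
  measurable_fun setT f -> measurable_fun setT g ->
  (forall x, 0 <= f x) -> (forall x, f x <= g x) ->
  integral_Rp f <= integral_Rp g.
Proof.
elim: p f g => [|p IH] f g mf mg f0 fg /=; first exact: fg.
have g0 x : 0 <= g x by exact: le_trans (fg x).
apply: ge0_le_integral => //.
- by move=> x _; apply: integral_Rp_ge0.
- exact: measurable_integral_Rp_cons.
- exact: measurable_integral_Rp_cons.
- by move=> x _; apply: IH => //; exact: measurable_cons_slice.
Qed.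

Lemma integral_RpZl p (f : p.-tuple R -> \bar R) (k : R) : (0 <= k)%R ->
  measurable_fun setT f -> (forall x, 0 <= f x) ->
  integral_Rp (fun x => k%:E * f x) = k%:E * integral_Rp f.
Proof.
move=> k0; elim: p f => [//|p IH] f mf f0 /=.
rewrite -ge0_integralZl_EFin//.
- apply: eq_integral => x _; apply: (IH (fun t => f [tuple of x :: t])) => //.
  exact: measurable_cons_slice.
- by move=> x _; apply: integral_Rp_ge0.
- exact: measurable_integral_Rp_cons.
Qed.

Lemma measurable_scale_tuple p (k : R) :
  measurable_fun [set: p.-tuple R]
    (fun x : p.-tuple R => [tuple of map ( *%R k) x]).
Proof.
apply/measurable_fun_tnthP => i.
rewrite (_ : _ \o _ = fun x : p.-tuple R => (k * tnth x i)%R); last first.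
  by apply/funext => x /=; rewrite tnth_map.
apply: measurable_funM => //; exact: measurable_tnth.
Qed.

(** The outer integral is dilated in one dimension and the inner one by induction; each coordinate
    gives one factor k. *)
Lemma integral_Rp_scale p (f : p.-tuple R -> \bar R) (k : R) : (0 < k)%R ->
  measurable_fun setT f -> (forall x, 0 <= f x) ->
  integral_Rp f =
  (k ^+ p)%:E * integral_Rp (fun x => f [tuple of map ( *%R k) x]).
Proof.
move=> k0; elim: p f => [|p IH] f mf f0.
  by rewrite mul1e /=; congr f; apply: val_inj.
have fE x (t : p.-tuple R) : f [tuple of map ( *%R k) [tuple of x :: t]] =
    f [tuple of (k * x)%R :: [tuple of map ( *%R k) t]].
  by congr f; exact: val_inj.
rewrite integral_RpS (ge0_integral_scale k0); last 2 first.
- exact: measurable_integral_Rp_cons.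
- by move=> x; exact: integral_Rp_ge0.
rewrite exprS EFinM -muleA integral_RpS; congr (_ * _).
rewrite -ge0_integralZl_EFin//.
- apply: eq_integral => x _.
  rewrite (IH (fun t => f [tuple of (k * x)%R :: t]))//.
    by congr (_ * integral_Rp _); apply/funext => t; rewrite fE.
  exact: measurable_cons_slice.
- by move=> x _; apply: integral_Rp_ge0.
- apply: (@measurable_integral_Rp_cons _ (fun x => f [tuple of map ( *%R k) x])) => //.
  exact: measurableT_comp mf (@measurable_scale_tuple p.+1 k).
- by rewrite exprn_ge0 ?ltW.
Qed.

End IteratedIntegral.

(** * Tail bounds for the Gamma and the Gaussian noise *)

Section Noise.
Context {R : realType}.

(** Apply exp y >= 1 + y at y = K / eta. *)
Lemma expRN_small (K eta : R) : 0 <= K -> 0 < eta ->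
  exists2 y, 0 <= y & K * expR (- y) <= eta.
Proof.
move=> K0 e0; exists (K / eta); first by rewrite divr_ge0// ltW.
rewrite expRN ler_pdivrMr ?expR_gt0// (le_trans _ (ler_wpM2l (ltW e0) (expR_ge1Dx _)))//.
by rewrite mulrDr mulr1 mulrCA divff ?gt_eqF// mulr1 lerDr ltW.
Qed.

Lemma measurable_norm2 p :
  measurable_fun [set: p.-tuple R] (fun x => norm2 (vec_of_tuple x)).
Proof.
apply: (measurableT_comp (f := @Num.sqrt R)).
  by apply: continuous_measurable_fun; exact: sqrt_continuous.
apply: measurable_sum => i; apply: measurable_funX.
rewrite (_ : (fun _ => _) = (@tnth p R ^~ i)); first exact: measurable_tnth.
by apply/funext => x; rewrite mxE.
Qed.

Lemma measurable_norm2_gt p (s : R) :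
  measurable [set x : p.-tuple R | s < norm2 (vec_of_tuple x)].
Proof.
rewrite -[X in measurable X]setTI; have := @measurable_norm2 p measurableT `]s, +oo[%classic.
rewrite (_ : _ @^-1` _ = [set x : p.-tuple R | s < norm2 (vec_of_tuple x)]); first exact.
by apply/seteqP; split => x /=; rewrite in_itv/= andbT.
Qed.

Lemma norm2_scale p (k : R) (v : 'rV[R]_p) : norm2 (k *: v) = `|k| * norm2 v.
Proof.
rewrite /norm2 -sqrtr_sqr -sqrtrM ?sqr_ge0// mulr_sumr; congr Num.sqrt.
by apply: eq_bigr => i _; rewrite mxE exprMn.
Qed.

Context d {T : measurableType d} (P : probability T R).

(** The constant [c] is never computed: total mass 1 at rate beta means mass 2^p at rate beta / 2,
    and on s < |x| the first density is at most exp(- beta s / 2) times the second. *)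
Lemma gamma_noise_tail p (beta s : R) (b : {RV P >-> p.-tuple R}) :
  0 < beta -> gamma_noise beta b ->
  (P (b @^-1` [set x | (s < norm2 (vec_of_tuple x))%R]) <=
   (2 ^+ p * expR (- (beta * s / 2)))%:E)%E.
Proof.
move=> b0 [c bc].
pose g k (x : p.-tuple R) := (c * expR (- (k * norm2 (vec_of_tuple x))))%:E.
have mg k : measurable_fun setT (g k).
  apply/measurable_EFinP/measurable_funM => //; apply: measurableT_comp => //.
  by apply: measurable_funN; apply: measurable_funM => //; exact: measurable_norm2.
have g1 : integral_Rp (g beta) = 1%E.
  rewrite -(probability_setT P) -(preimage_setT b) bc//.
  by congr integral_Rp; apply/funext => x; rewrite indicT mul1r.
(* [gamma_noise] leaves the sign of [c] open, but a negative [c] would make the total mass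
   nonpositive. *)
have c0 : 0 <= c.
  rewrite leNgt; apply/negP => c0.
  suff : (integral_Rp (g beta) <= 0)%E by rewrite g1 lee_fin ler10.
  by apply: integral_Rp_le0 => x; rewrite lee_fin nmulr_rle0 ?expR_ge0.
have g0 k x : (0 <= g k x)%E by rewrite lee_fin mulr_ge0 ?expR_ge0.
have g2 : integral_Rp (g (beta / 2)) = (2 ^+ p)%:E.
  rewrite (@integral_Rp_scale _ _ _ 2)// -[RHS]mule1 -g1; congr (_ * integral_Rp _)%E.
  apply/funext => x; rewrite /g; congr (_ * expR (- _))%:E.
  rewrite (_ : vec_of_tuple _ = 2 *: vec_of_tuple x).
    by rewrite norm2_scale gtr0_norm// mulrA divfK.
  by apply/rowP => i; rewrite !mxE tnth_map.
rewrite bc; last exact: measurable_norm2_gt.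
rewrite mulrC EFinM -g2 -integral_RpZl ?expR_ge0//.
apply: le_integral_Rp => //.
- apply/measurable_EFinP; apply: measurable_funM.
    by apply: measurable_indic; exact: measurable_norm2_gt.
  by have /measurable_EFinP := mg beta.
- exact: measurable_funeM.
- by move=> x; rewrite lee_fin !mulr_ge0 ?expR_ge0.
move=> x; rewrite /g -EFinM lee_fin indicE.
have [/set_mem/= sx|_] := boolP (x \in _); last first.
  by rewrite mul0r !mulr_ge0 ?expR_ge0.
rewrite mul1r mulrCA ler_wpM2l// -expRD ler_expR.
rewrite -subr_ge0 (_ : _ - _ = beta / 2 * (norm2 (vec_of_tuple x) - s)).
  by rewrite mulr_ge0 ?divr_ge0 ?(ltW b0)// subr_ge0 ltW.
by field.
Qed.

Lemma measurable_normr_gt (t : R) : measurable [set x : R | t < `|x|].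
Proof.
rewrite -[X in measurable X]setTI.
have := @normr_measurable R setT measurableT `]t, +oo[%classic.
rewrite (_ : _ @^-1` _ = [set x : R | t < `|x|]); first exact.
by apply/seteqP; split => x /=; rewrite in_itv/= andbT.
Qed.

(* On [t < |x|], the density of N(0, s^2) is at most [2 exp(-t^2 / 4 s^2)] times
   that of N(0, 2 s^2). *)
Lemma normal_prob_tail (sigma t : R) : 0 < sigma -> 0 <= t ->
  (normal_prob 0 sigma [set x : R | (t < `|x|)%R] <=
   (2 * expR (- (t ^+ 2 / (4 * sigma ^+ 2))))%:E)%E.
Proof.
move=> s0 t0; have st0 : 0 < Num.sqrt 2 * sigma by rewrite mulr_gt0.
have mA := measurable_normr_gt t.
rewrite /normal_prob.
set K := 2 * _.
have K0 : 0 <= K by rewrite mulr_ge0 ?expR_ge0.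
have mpdf (s : R) : measurable_fun setT (fun x => (normal_pdf 0 s x)%:E).
  by apply/measurable_EFinP; exact: measurable_normal_pdf.
have pdf0 (s x : R) : (0 <= (normal_pdf 0 s x)%:E)%E.
  by rewrite lee_fin normal_pdf_ge0.
rewrite -[leRHS]mule1 -(integral_normal_pdf 0 (Num.sqrt 2 * sigma)).
rewrite -ge0_integralZl_EFin//; last exact: mpdf.
apply: (@le_trans _ _ (\int[lebesgue_measure]_(x in [set x : R | (t < `|x|)%R])
   (K%:E * (normal_pdf 0 (Num.sqrt 2 * sigma) x)%:E))%E); last first.
  apply: ge0_subset_integral => //.
  - by apply: measurable_funeM; exact: mpdf.
  - by move=> x _; rewrite mule_ge0.
apply: ge0_le_integral => //.
- by apply: measurable_funTS; exact: mpdf.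
- by apply: measurable_funeM; apply: measurable_funTS; exact: mpdf.
move=> x /= tx; rewrite -EFinM lee_fin !normal_pdfE ?gt_eqF//.
rewrite /normal_peak /normal_fun !subr0 exprMn sqr_sqrtr//.
rewrite -[2 * _ * pi *+ 2]mulr_natl -[sigma ^+ 2 * pi *+ 2]mulr_natl.
set A := 2 * (sigma ^+ 2 * pi).
have A0 : 0 < A by rewrite !mulr_gt0 ?exprn_gt0 ?pi_gt0.
rewrite (_ : 2 * (2 * _ * pi) = 2 * A); last by rewrite /A !mulrA.
clearbody A; rewrite (@sqrtrM _ 2)// invfM /K.
rewrite (_ : _ * (_ * _) = 2 * (Num.sqrt 2)^-1 * ((Num.sqrt A)^-1 *
   (expR (- (t ^+ 2 / (4 * sigma ^+ 2))) * expR (- x ^+ 2 / (2 * sigma ^+ 2 *+ 2)))));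
   last by ring.
apply: (@le_trans _ _ ((Num.sqrt A)^-1 *
    (expR (- (t ^+ 2 / (4 * sigma ^+ 2))) * expR (- x ^+ 2 / (2 * sigma ^+ 2 *+ 2))))).
  rewrite ler_wpM2l ?invr_ge0// -expRD ler_expR.
  have -> : - x ^+ 2 / (sigma ^+ 2 *+ 2) =
      - (x ^+ 2 / (4 * sigma ^+ 2)) + - x ^+ 2 / (2 * sigma ^+ 2 *+ 2).
    by field; rewrite gt_eqF.
  rewrite lerD2r lerN2 ler_pM2r ?invr_gt0 ?mulr_gt0 ?exprn_gt0//.
  by rewrite -(real_normK (num_real x)) ler_sqr ?nnegrE// ltW.
(* The peak of N(0, 2 sigma^2) is lower by the factor sqrt 2, which the constant 2 outweighs. *)
apply: ler_peMl; first by rewrite !mulr_ge0 ?invr_ge0 ?expR_ge0.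
rewrite ler_pdivlMr ?sqrtr_gt0// mul1r -[leRHS]ger0_norm// -sqrtr_sqr.
by rewrite ler_wsqrtr// expr2 ler_pMl// ler1n.
Qed.

Lemma norm2_le_norm1 p (v : 'rV[R]_p) : norm2 v <= norm1 v.
Proof.
rewrite /norm2 -[leRHS]ger0_norm ?sumr_ge0// -sqrtr_sqr ler_wsqrtr// /norm1.
suff [] : 0 <= \sum_i `|v 0 i| /\
  \sum_i v 0 i ^+ 2 <= (\sum_i `|v 0 i|) ^+ 2 by [].
apply: (big_ind2 (fun x y : R => 0 <= x /\ y <= x ^+ 2)).
- by rewrite expr0n.
- by move=> x1 x2 y1 y2 [] ? ? [] ? ?; split; [exact: addr_ge0|nra].
- by move=> i _; rewrite real_normK ?num_real.
Qed.

(** If no coordinate exceeds s in absolute value, the l1 norm is at most p s; so the event lies in a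
    union of p one-dimensional tails. *)
Lemma gaussian_noise_tail p (sigma s : R) (b : {RV P >-> p.-tuple R}) :
  0 < sigma -> 0 <= s -> gaussian_noise sigma b ->
  (P (b @^-1` [set x | (p%:R * s < norm2 (vec_of_tuple x))%R]) <=
   (p%:R * (2 * expR (- (s ^+ 2 / (4 * sigma ^+ 2)))))%:E)%E.
Proof.
move=> s0 t0 bn.
(* Indexed by [nat], with default 0 beyond the tuple, to fit the Boole inequality; only indices
   below p occur. *)
pose A (i : nat) := b @^-1` [set x | s < `|nth 0 x i|].
have mA (i : 'I_p) : measurable (A i).
  rewrite (_ : A i = b @^-1` ((@tnth p R ^~ i) @^-1` [set x | s < `|x|])).
    rewrite -[X in measurable X]setTI; apply: measurable_funP => //.
    rewrite -[X in measurable X]setTI; apply: measurable_tnth => //.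
    exact: measurable_normr_gt.
  by rewrite /A; apply/seteqP; split => x /=; rewrite (tnth_nth 0).
apply: (@le_trans _ _ (P (\big[setU/set0]_(i < p) A i))).
  apply: le_measure; rewrite ?inE.
  - by rewrite -[X in measurable X]setTI; apply: measurable_funP => //;
      exact: measurable_norm2_gt.
  - by apply: bigsetU_measurable => i _; exact: mA.
  move=> omega /= h; rewrite -bigcup_seq.
  have [/existsP[i bi]|] := boolP [exists i, s < `|tnth (b omega) i|].
    by exists i; rewrite /= ?mem_index_enum// /A /= -tnth_nth.
  rewrite negb_exists => /forallP bs; move: h; rewrite ltNge => /negP[].
  rewrite (le_trans (norm2_le_norm1 _))// /norm1.
  rewrite mulr_natl -[in leRHS](card_ord p) -sumr_const ler_sum// => i _.
  by rewrite mxE leNgt.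
apply: (le_trans (Boole_inequality _ _)).
  by move=> i ip; exact: (mA (Ordinal ip)).
apply: (@le_trans _ _ (\sum_(i < p) (2 * expR (- (s ^+ 2 / (4 * sigma ^+ 2))))%:E)%E); last first.
  by rewrite sumEFin sumr_const card_ord [p%:R * _]mulr_natl.
apply: lee_sum => i _.
(* The law of coordinate i: all other factors of the product are the full line, of probability 1. *)
pose B (j : 'I_p) := if j == i then [set x : R | s < `|x|] else setT.
have mB j : measurable (B j).
  by rewrite /B; case: ifP => // _; exact: measurable_normr_gt.
rewrite (_ : A i = b @^-1` [set x | forall j, B j (tnth x j)]); last first.
  apply/seteqP; split => omega /=; rewrite /A /B /=.
    by move=> ? j; case: ifP => // /eqP ->; rewrite /= (tnth_nth 0).
  by move=> /(_ i); rewrite eqxx (tnth_nth 0).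
have /= -> := bn B mB.
rewrite (bigD1 i)//= big1 ?mule1.
  by rewrite /B eqxx; exact: normal_prob_tail.
by move=> j /negPf ji; rewrite /B ji; exact: probability_setT.
Qed.

(** [M] is chosen before [beta] and [b], so that one constant serves every n. *)
Lemma gamma_noise_bounded p (eta : R) : 0 < eta ->
  exists2 M : R, 0 <= M &
    forall (beta : R) (b : {RV P >-> p.-tuple R}), 0 < beta -> gamma_noise beta b ->
    (P (b @^-1` [set x | (M * beta^-1 < norm2 (vec_of_tuple x))%R]) <= eta%:E)%E.
Proof.
move=> eta0; have [//|y y0 yP] := @expRN_small (2 ^+ p) eta _ eta0.
exists (2 * y) => [|beta b b0 bn]; first by rewrite mulr_ge0.
apply: (le_trans (gamma_noise_tail _ b0 bn)); rewrite lee_fin.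
by rewrite (_ : beta * _ / 2 = y)//; field; rewrite gt_eqF.
Qed.

Lemma gaussian_noise_bounded p (eta : R) : 0 < eta ->
  exists2 M : R, 0 <= M &
    forall (sigma : R) (b : {RV P >-> p.-tuple R}), 0 < sigma -> gaussian_noise sigma b ->
    (P (b @^-1` [set x | (M * sigma < norm2 (vec_of_tuple x))%R]) <= eta%:E)%E.
Proof.
move=> eta0; have [//|y y0 yP] := @expRN_small (p%:R * 2) eta _ eta0.
(* At s = 2 (1 + y) sigma the exponent of the tail is (1 + y)^2 >= y; the factor p is the one of the
   union bound. *)
exists (p%:R * (2 * (1 + y))) => [|sigma b s0 bn].
  by rewrite !mulr_ge0// addr_ge0.
have t0 : 0 <= 2 * (1 + y) * sigma by rewrite !mulr_ge0 ?addr_ge0// ltW.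
rewrite -mulrA; apply: (le_trans (gaussian_noise_tail s0 t0 bn)); rewrite lee_fin.
rewrite mulrA (le_trans _ yP)// ler_wpM2l// ler_expR lerN2.
rewrite (_ : _ / _ = (1 + y) ^+ 2); last by field; rewrite gt_eqF.
nra.
Qed.

End Noise.

(** * Euclidean norm and inner product *)

Section Vectors.
Context {R : realType}.
Implicit Types p : nat.

Lemma norm2_ge0 p (v : 'rV[R]_p) : 0 <= norm2 v.
Proof. exact: sqrtr_ge0. Qed.

Lemma norm2_sqr p (v : 'rV[R]_p) : norm2 v ^+ 2 = dotv v v.
Proof.
rewrite sqr_sqrtr; last by apply: sumr_ge0 => i _; exact: sqr_ge0.
by apply: eq_bigr => i _; rewrite expr2.
Qed.

Lemma dotvC p (u v : 'rV[R]_p) : dotv u v = dotv v u.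
Proof. by apply: eq_bigr => i _; rewrite mulrC. Qed.

Lemma dotvDr p (u v v' : 'rV[R]_p) : dotv u (v + v') = dotv u v + dotv u v'.
Proof. by rewrite -big_split; apply: eq_bigr => i _; rewrite mxE mulrDr. Qed.

Lemma dotvNr p (u v : 'rV[R]_p) : dotv u (- v) = - dotv u v.
Proof. by rewrite -sumrN; apply: eq_bigr => i _; rewrite mxE mulrN. Qed.

(** Cauchy-Schwarz: the sum of the squares (b u_i - c v_i)^2 equals b (a b - c^2). If b = 0, every
    v_i vanishes. *)
Lemma sqr_sum_mul (I : finType) (u v : I -> R) :
  (\sum_i u i * v i) ^+ 2 <= (\sum_i u i ^+ 2) * (\sum_i v i ^+ 2).
Proof.
set a := \sum_i u i ^+ 2; set b := \sum_i v i ^+ 2; set c := \sum_i u i * v i.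
have b0 : 0 <= b by apply: sumr_ge0 => i _; exact: sqr_ge0.
have : 0 <= \sum_i (b * u i - c * v i) ^+ 2.
  by apply: sumr_ge0 => i _; exact: sqr_ge0.
rewrite (_ : \sum_i _ = b * (a * b - c ^+ 2)); last first.
  transitivity (\sum_i (b ^+ 2 * u i ^+ 2 - 2 * b * c * (u i * v i) + c ^+ 2 * v i ^+ 2)).
    by apply: eq_bigr => i _; ring.
  by rewrite big_split/= sumrB -!mulr_sumr -/a -/b -/c; ring.
move: b0; rewrite le_eqVlt => /predU1P[/esym b0 _|b0]; last by rewrite pmulr_rge0// subr_ge0.
rewrite b0 mulr0 /c big1 ?expr0n// => i _.
move/eqP: b0; rewrite psumr_eq0 => [/allP/(_ i)|j _]; last exact: sqr_ge0.
by rewrite mem_index_enum sqrf_eq0 => /(_ isT)/eqP ->; rewrite mulr0.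
Qed.

Lemma normr_dotv_le p (u v : 'rV[R]_p) : `|dotv u v| <= norm2 u * norm2 v.
Proof.
rewrite -ler_sqr ?nnegrE ?mulr_ge0 ?norm2_ge0// real_normK ?num_real// exprMn.
rewrite !sqr_sqrtr; last 2 first.
- by apply: sumr_ge0 => i _; exact: sqr_ge0.
- by apply: sumr_ge0 => i _; exact: sqr_ge0.
exact: sqr_sum_mul.
Qed.

Lemma norm2D p (u v : 'rV[R]_p) : norm2 (u + v) <= norm2 u + norm2 v.
Proof.
rewrite -ler_sqr ?nnegrE ?addr_ge0 ?norm2_ge0// sqrrD !norm2_sqr.
rewrite dotvDr ![dotv (u + v) _]dotvC !dotvDr (dotvC v u).
have := le_trans (ler_norm _) (normr_dotv_le u v); lra.
Qed.

Lemma normr_coord_le p (v : 'rV[R]_p) i : `|v 0 i| <= norm2 v.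
Proof.
rewrite -sqrtr_sqr ler_wsqrtr// (bigD1 i)//= lerDl.
by apply: sumr_ge0 => j _; exact: sqr_ge0.
Qed.

Lemma norm2_gt0 p (v : 'rV[R]_p) : (0 < norm2 v) = (v != 0).
Proof.
rewrite lt_neqAle norm2_ge0 andbT eq_sym; congr (~~ _); apply/eqP/eqP => [v0|->].
  apply/rowP => i; rewrite mxE; apply/eqP; rewrite -normr_le0 -v0.
  exact: normr_coord_le.
by rewrite /norm2 big1 ?sqrtr0// => i _; rewrite mxE expr0n.
Qed.

Lemma norm2N p (u : 'rV[R]_p) : norm2 (- u) = norm2 u.
Proof. by rewrite /norm2; congr Num.sqrt; apply: eq_bigr => i _; rewrite mxE sqrrN. Qed.

End Vectors.

(** * Convex and strongly convex functions on R^p *)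

Section Convex.
Context {R : realType} {p : nat}.
Implicit Types (f : 'rV[R]_p -> R) (x y : 'rV[R]_p).

Lemma convex_functionP f x y (t : R) :
  convex_function [set: 'rV[R]_p] f -> 0 <= t <= 1 ->
  f (t *: x + (1 - t) *: y) <= t * f x + (1 - t) * f y.
Proof.
by move=> cf /andP[t0 t1]; apply: (cf (Itv01 t0 t1) x y); rewrite inE.
Qed.

Lemma convex_setP (S : set 'rV[R]_p) x y (t : R) :
  convex_set S -> 0 <= t <= 1 -> S x -> S y -> S (t *: x + (1 - t) *: y).
Proof.
move=> cS /andP[t0 t1] Sx Sy.
have := cS x y (Itv01 t0 t1); rewrite !inE; exact.
Qed.

Lemma derive_gradient f x v : differentiable f x -> 'D_v f x = dotv (gradient f x) v.
Proof.
move=> df; rewrite deriveE// {1}(row_sum_delta v) linear_sum/=.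
by apply: eq_bigr => i _; rewrite linearZ/= mxE deriveE// mulrC.
Qed.

(** By convexity the difference quotients at x along y - x, with step 0 < h < 1, are at most f y - f
    x; let h tend to 0 from the right. *)
Lemma convex_gradient_le f x y : convex_function [set: 'rV[R]_p] f ->
  differentiable f x -> dotv (gradient f x) (y - x) <= f y - f x.
Proof.
move=> cf df; rewrite -derive_gradient//.
have /cvg_ex[l fl] : derivable f x (y - x) by exact: diff_derivable.
rewrite (_ : 'D_(y - x) f x = l); last exact: cvg_lim fl.
have {}fl := cvg_dnbhs_at_right fl.
rewrite -(cvg_lim _ fl)//; apply: limr_le; first exact: cvgP fl.
near=> h.
have h0 : 0 < h by near: h; exact: nbhs_right_gt.
have h1 : h < 1 by near: h; apply: nbhs_right_lt.
rewrite /= /GRing.scale/= ler_pdivrMl//.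
have hx : h *: (y - x) + x = h *: y + (1 - h) *: x.
  by rewrite scalerBr scalerBl scale1r -addrA [- _ + x]addrC.
have h01 : 0 <= h <= 1 by rewrite !ltW.
by rewrite hx; have := @convex_functionP f y x h cf h01; lra.
Unshelve. all: end_near. Qed.

(** Strong convexity at the midpoint, where f is at least f x, already gives the constant rho /
    4. *)
Lemma strongly_convex_argmin rho (S : set 'rV[R]_p) f x y :
  convex_set S -> strongly_convex rho S f -> is_argmin S f x -> S y ->
  rho / 4 * norm2 (y - x) ^+ 2 <= f y - f x.
Proof.
move=> cS sf [Sx fx] Sy.
have h01 : 0 <= (2^-1 : R) <= 1 by rewrite invr_ge0 ler0n invf_le1 ?ltr0n// ler1n.
have := sf y x _ Sy Sx h01; have := fx _ (convex_setP cS h01 Sy Sx); nra.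
Qed.

(* The cube is the convex hull of its corners; the coordinates are removed one
   at a time. *)
Lemma convex_function_bounded_cube f x : convex_function [set: 'rV[R]_p] f ->
  exists M : R, forall u : 'rV[R]_p, (forall i, `|u 0 i| <= 1) -> f (x + u) <= M.
Proof.
move=> cf; suff H k : forall x, exists M, forall u : 'rV[R]_p,
    (forall i, `|u 0 i| <= 1) -> (forall i : 'I_p, (k <= i)%N -> u 0 i = 0) ->
    f (x + u) <= M.
  have [M fM] := H p x; exists M => u u1; apply: fM => // i.
  by rewrite leqNgt ltn_ord.
elim: k => [|k IH] {}x.
  exists (f x) => u _ u0; rewrite (_ : u = 0) ?addr0//.
  by apply/rowP => i; rewrite mxE u0.
have [kp|pk] := ltnP k p; last first.
  have [M fM] := IH x; exists M => u u1 u0; apply: fM => // i ki.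
  by have := ltn_ord i; rewrite ltnNge (leq_trans pk ki).
pose e : 'rV[R]_p := delta_mx 0 (Ordinal kp).
have [M1 fM1] := IH (x + e); have [M2 fM2] := IH (x - e).
exists (Num.max M1 M2) => u u1 u0.
pose a := u 0 (Ordinal kp); pose v := u - a *: e.
have vE i : v 0 i = if i == Ordinal kp then 0 else u 0 i.
  rewrite !mxE eqxx/=; case: eqP => [->|_]; first by rewrite mulr1 subrr.
  by rewrite mulr0 subr0.
have v1 i : `|v 0 i| <= 1 by rewrite vE; case: ifP; rewrite ?normr0.
have v0 (i : 'I_p) : (k <= i)%N -> v 0 i = 0.
  rewrite vE; case: eqP => // /eqP ik ki; apply: u0.
  by rewrite ltn_neqAle ki andbT eq_sym.
have /ler_normlP[a1 a2] : `|a| <= 1 by exact: u1.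
(* With weight (1 + a) / 2, the point x + u is a convex combination of x + e + v and x - e + v,
   where v is u with coordinate k erased. *)
have h01 : 0 <= (1 + a) / 2 <= 1 by apply/andP; split; lra.
have := convex_functionP (x + e + v) (x - e + v) cf h01.
rewrite (_ : _ *: _ + _ *: _ = x + u); last first.
  by apply/rowP => i; rewrite /v !mxE; field.
move=> /le_trans; apply.
have := fM1 _ v1 v0; have := fM2 _ v1 v0.
have : M1 <= Num.max M1 M2 by rewrite le_max lexx.
have : M2 <= Num.max M1 M2 by rewrite le_max lexx orbT.
by move: (Num.max M1 M2) (f (x + e + v)) (f (x - e + v)) => M f1 f2; nra.
Qed.

(* [x] lies between [y] and the point at distance 1 from [x] opposite to [y],
   where [f] is bounded above. *)
Lemma convex_function_ge f x : convex_function [set: 'rV[R]_p] f ->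
  exists2 C, 0 <= C & forall y, f x - f y <= C * norm2 (y - x).
Proof.
move=> cf; have [M fM] := convex_function_bounded_cube x cf.
have M0 : 0 <= M - f x.
  by rewrite subr_ge0 -{1}[x]addr0 fM// => i; rewrite mxE normr0.
exists (M - f x) => // y; have [->|yx] := eqVneq y x.
  by rewrite !subrr mulr_ge0// norm2_ge0.
set s := norm2 (y - x).
have s0 : 0 < s by rewrite norm2_gt0 subr_eq0.
have uM : f (x + s^-1 *: (x - y)) <= M.
  apply: fM => i; rewrite mxE normrM gtr0_norm ?invr_gt0// ler_pdivrMl// mulr1.
  by rewrite -opprB mxE normrN normr_coord_le.
(* The distances from x to y and to the opposite point are s and 1, so y has weight 1 / (1 + s). *)
have h01 : 0 <= (1 + s)^-1 <= 1.
  by rewrite invr_ge0 invf_le1 ?addr_gt0// lerDl addr_ge0 ltW.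
have := convex_functionP y (x + s^-1 *: (x - y)) cf h01.
rewrite (_ : _ *: _ + _ *: _ = x); last first.
  by apply/rowP => i; rewrite !mxE; field; rewrite !gt_eqF// addr_gt0.
rewrite (_ : 1 - (1 + s)^-1 = s * (1 + s)^-1); last first.
  by field; rewrite gt_eqF// addr_gt0.
rewrite -mulrA mulrCA -mulrDr ler_pdivlMl ?addr_gt0//; nra.
Qed.

End Convex.

(** * Comparison of the two weight sensitivities *)

Section Weights.
Context {R : realType}.

(** Cauchy-Schwarz against the indicator of the support. *)
Lemma norm1_sqr_le n (v : 'rV[R]_n) : norm1 v ^+ 2 <= norm2 v ^+ 2 * (norm0 v)%:R.
Proof.
have := sqr_sum_mul (fun i => `|v 0 i|) (fun i => (v 0 i != 0)%:R).
rewrite (eq_bigr (fun i => `|v 0 i|)) => [h|i _]; last first.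
  by case: eqP => [->|_]; rewrite ?normr0 ?mul0r ?mulr1.
rewrite (le_trans h)// /norm2 sqr_sqrtr; last by apply: sumr_ge0 => i _; exact: sqr_ge0.
rewrite le_eqVlt; apply/orP; left; apply/eqP; congr (_ * _).
  by apply: eq_bigr => i _; rewrite real_normK ?num_real.
rewrite /norm0 -sum1_card natr_sum [RHS]big_mkcond/=; apply: eq_bigr => i _.
by rewrite inE; case: eqP; rewrite ?expr0n ?expr1n.
Qed.

Lemma W1_ge0 n (w w' : 'rV[R]_n) : 0 <= W1 w w'.
Proof.
by rewrite /W1 addr_ge0 ?sumr_ge0// mulr_ge0// bigmax_ge_id.
Qed.

Lemma W2_ge0 n (w w' : 'rV[R]_n) : 0 <= W2 w w'.
Proof. exact: sqrtr_ge0. Qed.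

(* Cauchy-Schwarz on the support of [w - w'] gives ||w - w'||_1 <= W2, which is
   what the factor 1 + ||w - w'||_0 of W2 is for. *)
Lemma W1_le_W2 n (w w' : 'rV[R]_n) : (forall i, 0 <= w 0 i) -> (forall i, 0 <= w' 0 i) ->
  W1 w w' <= 3 * W2 w w'.
Proof.
move=> w0 w'0; rewrite /W1 /W2.
set q := \big[Num.max/0]_i (w 0 i * w' 0 i).
set m := \big[Num.max/0]_i Num.min _ _.
have q0 : 0 <= q by exact: bigmax_ge_id.
have N0 : 0 <= (norm0 (w - w'))%:R :> R by [].
(* The square of a minimum is at most the product. *)
have mq : m <= Num.sqrt q.
  apply: bigmax_le => [|i _]; first exact: sqrtr_ge0.
  have min0 : 0 <= Num.min (w 0 i) (w' 0 i) by rewrite le_min w0 w'0.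
  rewrite -(ger0_norm min0) -sqrtr_sqr ler_wsqrtr//.
  rewrite (@le_trans _ _ (w 0 i * w' 0 i))//; last exact: (@le_bigmax _ _ _ 0).
  by rewrite expr2 ler_pM// ge_min lexx ?orbT.
set A := norm2 _ ^+ 2; rewrite natrD; set N := (norm0 _)%:R.
have A0 : 0 <= A by exact: sqr_ge0.
have n1 : norm1 (w - w') <= Num.sqrt ((A + 2 * q) * (1%:R + N)).
  rewrite -[leLHS]ger0_norm ?sumr_ge0// -sqrtr_sqr ler_wsqrtr//.
  rewrite (le_trans (norm1_sqr_le _))// -/A -/N; nra.
have m2 : m <= Num.sqrt ((A + 2 * q) * (1%:R + N)).
  rewrite (le_trans mq)// ler_wsqrtr//; nra.
(* The l1 norm and [m] are both at most W2, and [m] counts twice: hence 3. *)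
lra.
Qed.

Context {X : Type}.

Lemma Wbar_ge n (W : 'rV[R]_n -> 'rV[R]_n -> R) (w : dataset n -> 'rV[R]_n)
    (D D' : @dataset X n) :
  Defs.adjacent D D' -> ((W (w D) (w D'))%:E <= Wbar W w)%E.
Proof. by move=> DD'; apply: ereal_sup_ubound; exists D, D'. Qed.

(** A dataset is adjacent to itself, so the supremum is over a nonempty set; [adjacent] asks for an
    index, hence 0 < n. *)
Lemma Wbar_ge0 n (W : 'rV[R]_n -> 'rV[R]_n -> R) (w : @dataset X n -> 'rV[R]_n) :
  (0 < n)%N -> @dataset X n -> (forall u v, 0 <= W u v) -> (0 <= Wbar W w)%E.
Proof.
move=> n0 D W0; apply: (@le_trans _ _ (W (w D) (w D))%:E); first by rewrite lee_fin.
by apply: Wbar_ge; exists (Ordinal n0).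
Qed.

Lemma le_Wbar n (W W' : 'rV[R]_n -> 'rV[R]_n -> R) (w : @dataset X n -> 'rV[R]_n) (c : R) :
  0 <= c -> (forall D D', W (w D) (w D') <= c * W' (w D) (w D')) ->
  (Wbar W w <= c%:E * Wbar W' w)%E.
Proof.
move=> c0 WW'; apply: ge_ereal_sup => _ [D [D' [DD' ->]]].
apply: (@le_trans _ _ (c%:E * (W' (w D) (w D'))%:E)%E).
  by rewrite -EFinM lee_fin.
by rewrite lee_wpmul2l ?lee_fin//; exact: Wbar_ge.
Qed.

End Weights.

(** * Deterministic bounds for a fixed noise vector *)

Section Perturbation.
Context {R : realType} {X : Type} {n p : nat}.
Context (w : 'rV[R]_n) (ell : 'rV[R]_p -> X -> R) (reg : 'rV[R]_p -> R)
  (D : @dataset X n) (Theta : set 'rV[R]_p).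
Local Notation L := (loss2 w ell reg D).

Section Minimizer.
Context (gamma : R) (v to tp : 'rV[R]_p) (Tto : Theta to)
  (tpP : is_argmin Theta (private_loss2 w ell reg gamma v D) tp).
Let N : R := norm2 v / n%:R.

Let N0 : 0 <= N. Proof. by rewrite divr_ge0 ?norm2_ge0. Qed.

Let basic : L tp - L to <=
  gamma / 2 * (norm2 to ^+ 2 - norm2 tp ^+ 2) + dotv v (to - tp) / n%:R.
Proof.
have := tpP.2 _ Tto; rewrite /private_loss2 dotvDr dotvNr mulrDl mulNr; lra.
Qed.

Let dot_le u : dotv v u / n%:R <= N * norm2 u.
Proof.
rewrite /N mulrAC ler_wpM2r ?invr_ge0//.
exact: le_trans (ler_norm _) (normr_dotv_le _ _).
Qed.

(** For the case rho = 0: the regularizer at [tp] absorbs N |tp|, so that only |to| remains. *)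
Lemma private_excess_le : 0 < gamma ->
  L tp - L to <= gamma / 2 * norm2 to ^+ 2 + N * norm2 to + N ^+ 2 / (2 * gamma).
Proof.
move=> g0; apply: (le_trans basic).
have := dot_le (to - tp); have := norm2D to (- tp); rewrite norm2N.
move: (norm2_ge0 to) (norm2_ge0 tp) => to0 tp0 h1 h2.
(* Young *)
have : N * norm2 tp <= gamma / 2 * norm2 tp ^+ 2 + N ^+ 2 / (2 * gamma).
  rewrite -subr_ge0 (_ : _ - _ = (gamma * norm2 tp - N) ^+ 2 / (2 * gamma)).
    by rewrite divr_ge0 ?sqr_ge0// mulr_ge0// ltW.
  by field; rewrite gt_eqF.
have : N * norm2 (to - tp) <= N * (norm2 to + norm2 tp) by rewrite ler_wpM2l.
lra.
Qed.

(** With t = |tp - to|, quadratic growth and [basic] give rho/4 t^2 <= excess <= e t + rho/8 t^2,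
    hence t <= 8 e / rho. The sign of [gamma] is left open, hence the absolute values. *)
Lemma private_excess_strong rho (e := `|gamma| * norm2 to + N) :
  convex_set Theta -> 0 < rho -> strongly_convex rho Theta L ->
  is_argmin Theta L to -> `|gamma| <= rho / 4 ->
  norm2 (tp - to) <= 8 / rho * e /\ L tp - L to <= 16 / rho * e ^+ 2.
Proof.
move=> cT rho0 sL toP grho.
have growth := strongly_convex_argmin cT sL toP tpP.1.
set t := norm2 (tp - to) in growth *.
have t0 : 0 <= t := norm2_ge0 _.
have e0 : 0 <= e by rewrite addr_ge0 ?mulr_ge0 ?norm2_ge0.
have excess_le : L tp - L to <= e * t + rho / 8 * t ^+ 2.
  apply: (le_trans basic).
  have := dot_le (to - tp); rewrite -(norm2N (to - tp)) opprB -/t => h1.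
  have -> : norm2 to ^+ 2 - norm2 tp ^+ 2 = - (2 * dotv to (tp - to) + t ^+ 2).
    rewrite /t -{1}[tp](subrK to); move: (tp - to) => u.
    rewrite !norm2_sqr !dotvDr ![dotv (u + to) _]dotvC !dotvDr (dotvC u to); ring.
  have h2 : - gamma * dotv to (tp - to) <= `|gamma| * (norm2 to * t).
    apply: (le_trans (ler_norm _)).
    by rewrite normrM normrN ler_wpM2l// normr_dotv_le.
  have h3 : - gamma * t ^+ 2 <= rho / 4 * t ^+ 2.
    by rewrite ler_wpM2r ?sqr_ge0// (le_trans _ grho)// -normrN ler_norm.
  rewrite /e; lra.
have te : t <= 8 / rho * e.
  move: t0; rewrite le_eqVlt => /predU1P[<-|t0].
    by rewrite mulr_ge0// divr_ge0// ltW.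
  rewrite mulrAC ler_pdivlMr//; nra.
split=> //; apply: (le_trans excess_le).
(* The upper bound e t + rho/8 t^2 evaluated at t = 8 e / rho. *)
have -> : 16 / rho * e ^+ 2 = e * (8 / rho * e) + rho / 8 * (8 / rho * e) ^+ 2.
  by field; rewrite gt_eqF.
have k0 : 0 <= rho / 8 by rewrite divr_ge0// ltW.
by rewrite lerD// ler_wpM2l// ler_sqr ?nnegrE// (le_trans t0).
Qed.

End Minimizer.

(** Quadratic growth of L between [to] and a reference point [t1] competes with an increment at most
    linear in |to - t1|. The weights are nonnegative with sum n, so the averaged loss keeps the
    constant zeta and the bound is free of n. *)
Lemma argmin_bounded rho zeta C (t1 to : 'rV[R]_p) :
  (0 < n)%N -> scaled_simplex w ->
  convex_set Theta -> 0 < rho -> strongly_convex rho Theta L ->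
  is_argmin Theta L to -> Theta t1 -> 0 <= zeta -> 0 <= C ->
  (forall x, ell t1 x - ell to x <= zeta * norm2 (to - t1)) ->
  reg t1 - reg to <= C * norm2 (to - t1) ->
  norm2 (to - t1) <= 4 / rho * (zeta + C).
Proof.
move=> n0 [w0 wn] cT rho0 sL toP Tt1 z0 C0 ellL regL.
have nR : 0 < n%:R :> R by rewrite ltr0n.
have := strongly_convex_argmin cT sL toP Tt1.
rewrite -norm2N opprB; set t := norm2 (to - t1) => growth.
have t0 : 0 <= t := norm2_ge0 _.
have : L t1 - L to <= (zeta + C) * t.
  rewrite /loss2 mulrDl opprD addrACA lerD// -mulrBr -sumrB.
  rewrite ler_pdivrMl// mulrC -[in leRHS]wn mulr_sumr ler_sum// => i _.
  by rewrite -mulrBr [leRHS]mulrC ler_wpM2l.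
move=> /(le_trans growth) {}growth.
move: t0; rewrite le_eqVlt => /predU1P[t0|t0]; last first.
  by rewrite mulrAC ler_pdivlMr//; nra.
by rewrite -t0 mulr_ge0 ?divr_ge0 ?addr_ge0// ltW.
Qed.

End Perturbation.

(** * Orders of magnitude in n *)

Section Rates.
Context {R : realType}.

(** Reduces a stochastic rate to a deterministic bound on the ball of radius M s_n. The exceptional
    event is the noise leaving this ball, measurable whatever [f] is. *)
Lemma stochastic_O_noise d (T : measurableType d) (P : probability T R) p
    (b : nat -> {RV P >-> p.-tuple R}) (s r : nat -> R) (f : nat -> 'rV[R]_p -> R) :
  (forall eta, 0 < eta -> exists2 M, 0 <= M & forall n,
    (P (b n @^-1` [set x | (M * s n < norm2 (vec_of_tuple x))%R]) <= eta%:E)%E) ->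
  (forall M, 0 <= M -> exists M', \forall n \near \oo,
    forall v, norm2 v <= M * s n -> `|f n v| <= M' * r n) ->
  stochastic_O P (fun n omega => f n (vec_of_tuple (b n omega))) r.
Proof.
move=> bs fr eta eta0; have [M M0 bM] := bs _ eta0.
have [M' fM'] := fr _ M0; exists M'; near=> n.
exists (b n @^-1` [set x | M * s n < norm2 (vec_of_tuple x)]); split => //.
  rewrite -[X in measurable X]setTI; apply: measurable_funP => //.
  exact: measurable_norm2_gt.
have fn : forall v, norm2 v <= M * s n -> `|f n v| <= M' * r n by near: n.
by move=> omega /=; rewrite !ltNge; apply: contra => /fn.
Unshelve. all: end_near. Qed.

(** The sign of [l] is open, as that of lambda is: |x| is at most C |l| when l >= 0, and at most |l|
    when l < 0 since then l <= x <= C l < 0. *)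
Lemma calibrated_normr (l x : nat -> R) : calibrated l x ->
  exists2 C, 0 <= C & \forall n \near \oo, `|x n| <= C * `|l n|.
Proof.
move=> [C C0 lx]; exists (1 + C); first by rewrite addr_ge0// ltW.
apply: filterS lx => n /andP[lx xl]; have := ler_norm (l n); have := ler_norm (- l n).
rewrite normrN => h1 h2; rewrite ler_norml; apply/andP; split; nra.
Qed.

Lemma calibrated_gamma (lambda epsilon C : R) (r2 gamma : nat -> R) :
  0 < epsilon ->
  (\forall n \near \oo, 0 <= r2 n <= C * Num.sqrt n%:R) ->
  calibrated (fun n => 2 * lambda / (epsilon * n%:R) * r2 n) gamma ->
  exists2 G, 0 <= G & \forall n \near \oo, `|gamma n| <= G / Num.sqrt n%:R.
Proof.
move=> e0 r2C /calibrated_normr[A A0 gA].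
exists (A * (2 * `|lambda| / epsilon * `|C|)).
  by rewrite !mulr_ge0 ?invr_ge0// ltW.
near=> n.
have q0 : 0 < Num.sqrt n%:R :> R.
  by rewrite sqrtr_gt0 ltr0n; near: n; exact: nbhs_infty_gt.
have nq : n%:R = Num.sqrt n%:R ^+ 2 :> R by rewrite sqr_sqrtr.
have /andP[r0 rC] : 0 <= r2 n <= C * Num.sqrt n%:R by near: n.
have gn : `|gamma n| <= A * `|2 * lambda / (epsilon * n%:R) * r2 n| by near: n.
apply: (le_trans gn); rewrite -[leRHS]mulrA ler_wpM2l//.
move: q0 rC nq; set q := Num.sqrt _ => q0 rC ->.
rewrite !normrM (ger0_norm r0) normfV normrM (gtr0_norm e0) normr_nat.
rewrite (ger0_norm (sqr_ge0 q)).
rewrite (_ : _ * `|C| / q = 2 * `|lambda| / (epsilon * q ^+ 2) * (`|C| * q)); last first.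
  by field; rewrite !gt_eqF.
rewrite ler_wpM2l ?divr_ge0 ?mulr_ge0 ?(ltW e0) ?(ltW q0)//.
by rewrite (le_trans rC)// ler_wpM2r ?ler_norm// ltW.
Unshelve. all: end_near. Qed.

(** The bound has the form shared with Gaussian noise, where the square root produces the linear
    term. *)
Lemma gamma_scale_le (zeta epsilon : R) (r1 s : nat -> R) :
  (forall n, 0 < s n) -> (\forall n \near \oo, 0 <= r1 n) ->
  calibrated (fun n => 2 * zeta / epsilon * r1 n) s ->
  exists2 K, 0 <= K & \forall n \near \oo, s n ^+ 2 <= K * (r1 n ^+ 2 + r1 n).
Proof.
move=> s0 r10 [C C0 sC]; exists ((C * (2 * zeta / epsilon)) ^+ 2); first exact: sqr_ge0.
near=> n; have r0 : 0 <= r1 n by near: n.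
have /andP[_ sn] : 2 * zeta / epsilon * r1 n <= s n <= C * (2 * zeta / epsilon * r1 n).
  by near: n.
rewrite mulrA in sn.
apply: (@le_trans _ _ ((C * (2 * zeta / epsilon)) ^+ 2 * r1 n ^+ 2)).
  by rewrite -exprMn ler_sqr ?nnegrE ?(ltW (s0 n))// (le_trans (ltW (s0 n))).
by rewrite ler_wpM2l ?sqr_ge0// lerDl.
Unshelve. all: end_near. Qed.

(** With v the square root, (l + v)^2 <= 2 (l^2 + v^2) = 4 l^2 + 2 epsilon / r; multiplying by r^2
    leaves a quadratic and a linear term in r. *)
Lemma gaussian_scale_le (zeta epsilon l : R) (r1 s : nat -> R) : 0 < epsilon ->
  (forall n, 0 < s n) -> (\forall n \near \oo, 0 <= r1 n) ->
  calibrated (fun n => zeta / epsilon *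
    (l + Num.sqrt (l ^+ 2 + epsilon / r1 n)) * r1 n) s ->
  exists2 K, 0 <= K & \forall n \near \oo, s n ^+ 2 <= K * (r1 n ^+ 2 + r1 n).
Proof.
move=> e0 s0 r10 [C C0 sC].
exists ((C * (zeta / epsilon)) ^+ 2 * (4 * l ^+ 2 + 2 * epsilon)).
  by rewrite mulr_ge0 ?sqr_ge0//; have := sqr_ge0 l; lra.
near=> n; have : 0 <= r1 n by near: n.
have : zeta / epsilon * (l + Num.sqrt (l ^+ 2 + epsilon / r1 n)) * r1 n <= s n <=
    C * (zeta / epsilon * (l + Num.sqrt (l ^+ 2 + epsilon / r1 n)) * r1 n).
  by near: n.
(* If r = 0, the calibration forces s n <= 0, a contradiction; so the division by r is genuine. *)
move: (s0 n) (r1 n) => sn0 r /andP[_ sn]; rewrite le_eqVlt => /predU1P[r0|r0].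
  by move: sn; rewrite -r0 !mulr0 leNgt sn0.
set v := Num.sqrt _ in sn.
have v2 : v ^+ 2 = l ^+ 2 + epsilon / r.
  by rewrite sqr_sqrtr// addr_ge0 ?sqr_ge0// divr_ge0// ltW.
set k := C * (zeta / epsilon).
have {}sn : s n <= k * (l + v) * r by rewrite /k -!mulrA; rewrite -!mulrA in sn.
apply: (@le_trans _ _ ((k * (l + v) * r) ^+ 2)).
  by rewrite ler_sqr ?nnegrE ?(ltW sn0)// (le_trans (ltW sn0)).
have -> : (k * (l + v) * r) ^+ 2 = k ^+ 2 * ((l + v) ^+ 2 * r ^+ 2) by ring.
move: (k ^+ 2) (sqr_ge0 k) => k2 k20; rewrite -[leRHS]mulrA ler_wpM2l//.
have lv : (l + v) ^+ 2 <= 2 * (l ^+ 2 + v ^+ 2).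
  have := sqr_ge0 (l - v); nra.
apply: (le_trans (ler_wpM2r (sqr_ge0 _) lv)).
rewrite v2 (_ : 2 * _ * _ = 4 * l ^+ 2 * r ^+ 2 + 2 * epsilon * r); last first.
  by field; rewrite gt_eqF.
have := sqr_ge0 l; have := sqr_ge0 r; nra.
Unshelve. all: end_near. Qed.

Lemma noise_scale_le_sqrt (K C : R) (r1 s : nat -> R) : 0 <= K ->
  (forall n, 0 < s n) ->
  (\forall n \near \oo, 0 <= r1 n <= C * Num.sqrt n%:R) ->
  (\forall n \near \oo, s n ^+ 2 <= K * (r1 n ^+ 2 + r1 n)) ->
  exists2 S, 0 <= S & \forall n \near \oo, s n <= S * Num.sqrt n%:R.
Proof.
move=> K0 s0 rC sK; exists (Num.sqrt (K * (C ^+ 2 + `|C|))) => //.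
near=> n.
have : 1 <= Num.sqrt n%:R :> R.
  by rewrite -[leLHS]sqrtr1 ler_wsqrtr// ler1n; near: n; exact: nbhs_infty_gt.
have : 0 <= r1 n <= C * Num.sqrt n%:R by near: n.
have : s n ^+ 2 <= K * (r1 n ^+ 2 + r1 n) by near: n.
set q := Num.sqrt n%:R => sn /andP[r0 rq] q1.
have q0 : 0 <= q by exact: le_trans q1.
rewrite -ler_sqr ?nnegrE ?mulr_ge0 ?(ltW (s0 n))// exprMn sqr_sqrtr; last first.
  by rewrite mulr_ge0// addr_ge0 ?sqr_ge0.
rewrite (le_trans sn)// -mulrA ler_wpM2l// mulrDl lerD//.
  by rewrite -exprMn ler_sqr ?nnegrE// (le_trans r0).
(* The linear term is at most |C| q, hence at most |C| q^2 because q >= 1. *)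
rewrite (le_trans rq)// (le_trans (ler_wpM2r q0 (ler_norm C)))// ler_wpM2l//.
by rewrite expr2 ler_peMl.
Unshelve. all: end_near. Qed.

(** Here q is sqrt n. One factor of (r1 + 1) r1 is bounded by (C + 1) q, the other by r1 <= 3 r2 and
    the calibration of g; the g thus gained cancels the one in the denominator. *)
Lemma noise_over_gamma_le (V M s K r1 r2 g lambda epsilon C q : R) :
  0 <= V -> V <= M * s -> 0 <= s -> 0 <= M -> 0 <= K -> s ^+ 2 <= K * (r1 ^+ 2 + r1) ->
  0 <= r1 <= C * q -> r1 <= 3 * r2 -> 0 < g -> 0 < lambda -> 0 < epsilon -> 1 <= q ->
  2 * lambda / (epsilon * q ^+ 2) * r2 <= g ->
  (V / q ^+ 2) ^+ 2 / (2 * g) <=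
  M ^+ 2 * K * (C + 1) * (3 * epsilon / (4 * lambda)) / q.
Proof.
move=> V0 VM s0 M0 K0 sK /andP[r0 rC] r12 g0 l0 e0 q1 lg.
have q0 : 0 < q by exact: lt_le_trans q1.
have r1g : r1 <= 3 * g * epsilon * q ^+ 2 / (2 * lambda).
  rewrite mulrAC ler_pdivrMr ?mulr_gt0 ?exprn_gt0// in lg.
  by rewrite ler_pdivlMr ?mulr_gt0//; nra.
have V2 : V ^+ 2 <= M ^+ 2 * (K * ((C + 1) * q * (3 * g * epsilon * q ^+ 2 / (2 * lambda)))).
  rewrite (@le_trans _ _ ((M * s) ^+ 2))//.
    by rewrite ler_sqr ?nnegrE ?mulr_ge0.
  rewrite exprMn ler_wpM2l ?sqr_ge0// (le_trans sK)// ler_wpM2l//.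
  rewrite (_ : r1 ^+ 2 + r1 = (r1 + 1) * r1); last by ring.
  by rewrite ler_pM ?addr_ge0//; lra.
rewrite (_ : (V / _) ^+ 2 / _ = V ^+ 2 * (2 * g * q ^+ 4)^-1); last first.
  by field; rewrite !gt_eqF.
rewrite ler_pdivrMr ?mulr_gt0 ?exprn_gt0// (le_trans V2)//.
by rewrite le_eqVlt; apply/orP; left; apply/eqP; field; rewrite !gt_eqF.
Qed.

End Rates.

(** * Stochastic rates for the private estimator *)

Theorem theorem3p6 (R : realType) (p : nat) (X : Type)
  (* first stage *)
  (V : nat -> normedModType R) (Xi : forall n, set (V n))
  (E : forall n, @dataset X n -> V n -> R)
  (lambdastar : forall n, @dataset X n -> V n)
  (F : forall n, V n -> 'rV[R]_n)
  (Xi_closed : forall n, (0 < n)%N -> closed (Xi n))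
  (Xi_convex : forall n, (0 < n)%N -> convex_set (Xi n))
  (E_convex : forall n (D : dataset n), (0 < n)%N ->
     convex_function (Xi n) (E n D))
  (lambdastarP : forall n (D : dataset n), (0 < n)%N ->
     is_argmin (Xi n) (E n D) (lambdastar n D))
  (F_simplex : forall n l, (0 < n)%N -> Xi n l -> scaled_simplex (F n l))
  (w : forall n, dataset n -> 'rV[R]_n)
  (wE : forall n (D : dataset n), w n D = F n (lambdastar n D))
  (* second stage *)
  (Theta : set 'rV[R]_p) (reg : 'rV[R]_p -> R) (ell : 'rV[R]_p -> X -> R)
  (Theta_closed : closed Theta) (Theta_convex : convex_set Theta)
  (reg_convex : convex_function [set: 'rV[R]_p] reg)
  (ell_convex : forall x, convex_function [set: 'rV[R]_p] (ell ^~ x))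
  (ell_C2 : forall x, continuous_hessian (ell ^~ x))
  (lambda zeta : R)
  (ell_trace : forall theta x, Theta theta ->
     \tr (hessian (ell ^~ x) theta) <= lambda)
  (ell_grad : forall theta x, Theta theta ->
     norm2 (gradient (ell ^~ x) theta) <= zeta)
  (* the datasets and the second-stage objective *)
  (D : forall n, @dataset X n) (L : nat -> 'rV[R]_p -> R)
  (LE : forall n, L n = loss2 (w n (D n)) ell reg (D n))
  (rho : R) (rho_ge0 : 0 <= rho)
  (L_strong : forall n, (0 < n)%N -> strongly_convex rho Theta (L n))
  (theta_opt : nat -> 'rV[R]_p)
  (theta_optP : forall n, (0 < n)%N -> is_argmin Theta (L n) (theta_opt n))
  (* weight sensitivities *)
  (Wbar1 Wbar2 : nat -> \bar R)
  (Wbar1E : forall n, Wbar1 n = Wbar (@W1 R n) (w n))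
  (Wbar2E : forall n, Wbar2 n = Wbar (@W2 R n) (w n))
  (Wbar1_O : bigO_sqrt Wbar1) (Wbar2_O : bigO_sqrt Wbar2)
  (* noise, private estimator and calibration *)
  (epsilon : R) (epsilon_gt0 : 0 < epsilon)
  (delta : R) (delta_gt0 : 0 < delta) (delta_lt1 : delta < 1)
  (d : measure_display) (T : measurableType d) (P : probability T R)
  (b : nat -> {RV P >-> p.-tuple R})
  (gamma : nat -> R) (theta_priv : nat -> 'rV[R]_p -> 'rV[R]_p)
  (theta_privP : forall n (v : 'rV[R]_p), (0 < n)%N ->
     is_argmin Theta
       (private_loss2 (w n (D n)) ell reg (gamma n) v (D n))
       (theta_priv n v))
  (gamma_calibrated :
     calibrated (fun n => 2 * lambda / (epsilon * n%:R) * fine (Wbar2 n)) gamma)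
  (noise :
     (exists beta : nat -> R,
        [/\ forall n, 0 < beta n,
            forall n, gamma_noise (beta n) (b n) &
            calibrated (fun n => 2 * zeta / epsilon * fine (Wbar1 n))
                       (fun n => (beta n)^-1)])
     \/
     (exists sigma : nat -> R,
        [/\ forall n, 0 < sigma n,
            forall n, gaussian_noise (sigma n) (b n) &
            calibrated (fun n => zeta / epsilon
                * (Ltilde p delta
                   + Num.sqrt (Ltilde p delta ^+ 2 + epsilon / fine (Wbar1 n)))
                * fine (Wbar1 n))
              sigma])) :
  let priv n omega := theta_priv n (vec_of_tuple (b n omega)) in
  let excess n omega := L n (priv n omega) - L n (theta_opt n) in
  (0 < rho ->
     stochastic_O P excess (fun n => n%:R^-1)
     /\ stochastic_O P (fun n omega => norm2 (priv n omega - theta_opt n))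
          (fun n => (Num.sqrt n%:R)^-1))
  /\
  (rho = 0 ->
     (\forall n \near \oo, 0 < gamma n) ->
     (exists B : R, \forall n \near \oo, norm2 (theta_opt n) <= B) ->
     stochastic_O P excess (fun n => (Num.sqrt n%:R)^-1)).
Proof.
move=> priv excess.
pose r1 n := fine (Wbar1 n); pose r2 n := fine (Wbar2 n).
have w_simplex n (D' : dataset n) : (0 < n)%N -> scaled_simplex (w n D').
  by move=> n0; rewrite wE; apply: F_simplex => //; exact: (lambdastarP n D' n0).1.
(* For large n both suprema are finite, so [fine] does not alter them. *)
have [C C0 rC] : exists2 C, 0 <= C & \forall n \near \oo,
    [/\ 0 <= r1 n <= C * Num.sqrt n%:R, 0 <= r2 n <= C * Num.sqrt n%:R &
        r1 n <= 3 * r2 n].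
  have [C1 C1P] := Wbar1_O; have [C2 C2P] := Wbar2_O.
  exists (`|C1| + `|C2|); first by rewrite addr_ge0.
  near=> n.
  have n0 : (0 < n)%N by near: n; exact: nbhs_infty_gt.
  have q0 : 0 <= Num.sqrt n%:R :> R by [].
  have W1C : (Wbar1 n <= (C1 * Num.sqrt n%:R)%:E)%E by near: n.
  have W2C : (Wbar2 n <= (C2 * Num.sqrt n%:R)%:E)%E by near: n.
  have W1p : (0 <= Wbar1 n)%E by rewrite Wbar1E Wbar_ge0//; exact: W1_ge0.
  have W2p : (0 <= Wbar2 n)%E by rewrite Wbar2E Wbar_ge0//; exact: W2_ge0.
  have W12 : (Wbar1 n <= 3%:E * Wbar2 n)%E.
    rewrite Wbar1E Wbar2E; apply: le_Wbar => // D1 D2.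
    by apply: W1_le_W2 => i; apply: (w_simplex _ _ n0).1.
  have f1 : Wbar1 n = (r1 n)%:E.
    by rewrite fineK// ge0_fin_numE// (le_lt_trans W1C)// ltry.
  have f2 : Wbar2 n = (r2 n)%:E.
    by rewrite fineK// ge0_fin_numE// (le_lt_trans W2C)// ltry.
  rewrite f1 lee_fin in W1p; rewrite f2 lee_fin in W2p.
  rewrite f1 f2 -EFinM lee_fin in W12.
  rewrite f1 lee_fin in W1C; rewrite f2 lee_fin in W2C.
  have := ler_wpM2r q0 (ler_norm C1); have := ler_wpM2r q0 (ler_norm C2).
  have := mulr_ge0 (normr_ge0 C1) q0; have := mulr_ge0 (normr_ge0 C2) q0.
  by rewrite W1p W2p => a1 a2 a3 a4; split => //=; lra.
have r1C : \forall n \near \oo, 0 <= r1 n <= C * Num.sqrt n%:R.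
  by apply: filterS rC => n [].
have r2C : \forall n \near \oo, 0 <= r2 n <= C * Num.sqrt n%:R.
  by apply: filterS rC => n [].
have r1_ge0 : \forall n \near \oo, 0 <= r1 n.
  by apply: filterS r1C => n /andP[].
have [G G0 gammaG] := calibrated_gamma epsilon_gt0 r2C gamma_calibrated.
(* A single scale s, equal to 1 / beta or sigma, replaces the two noise laws from here on. *)
have [s [s0 s_tail [K K0 sK]]] : exists s : nat -> R, [/\ forall n, 0 < s n,
    forall eta, 0 < eta -> exists2 M, 0 <= M & forall n,
      (P (b n @^-1` [set x | (M * s n < norm2 (vec_of_tuple x))%R]) <= eta%:E)%E &
    exists2 K, 0 <= K & \forall n \near \oo, s n ^+ 2 <= K * (r1 n ^+ 2 + r1 n)].
  case: noise => [[beta [beta0 bn cal]]|[sigma [sigma0 bn cal]]].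
    exists (fun n => (beta n)^-1); split => [n|eta eta0|]; first by rewrite invr_gt0.
      have [M M0 bM] := gamma_noise_bounded P p eta0.
      by exists M => // n; exact: bM.
    by apply: gamma_scale_le cal => // n; rewrite invr_gt0.
  exists sigma; split => // [eta eta0|].
    have [M M0 bM] := gaussian_noise_bounded P p eta0.
    by exists M => // n; exact: bM.
  exact: gaussian_scale_le cal.
have [S S0 sS] := noise_scale_le_sqrt K0 s0 r1C sK.
have excess_ge0 n v : (0 < n)%N -> 0 <= L n (theta_priv n v) - L n (theta_opt n).
  move=> n0; rewrite subr_ge0; apply: (theta_optP n n0).2.
  exact: (theta_privP n v n0).1.
have noise_le M : 0 <= M -> \forall n \near \oo, forall v : 'rV[R]_p,
    norm2 v <= M * s n -> norm2 v / n%:R <= M * S / Num.sqrt n%:R.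
  move=> M0; near=> n => v vM.
  have q0 : 0 < Num.sqrt n%:R :> R.
    by rewrite sqrtr_gt0 ltr0n; near: n; exact: nbhs_infty_gt.
  have nq : n%:R = Num.sqrt n%:R ^+ 2 :> R by rewrite sqr_sqrtr.
  have sn : s n <= S * Num.sqrt n%:R by near: n.
  have {}vM := le_trans vM (ler_wpM2l M0 sn).
  move: q0 nq vM; set q := Num.sqrt _ => q0 -> vM.
  rewrite ler_pdivrMr ?exprn_gt0// (le_trans vM)// le_eqVlt.
  by apply/orP; left; apply/eqP; field; rewrite gt_eqF.
split=> [rho0|rho0 gamma0 [B optB]].
  have [B B0 optB] : exists2 B, 0 <= B & forall n, (0 < n)%N -> norm2 (theta_opt n) <= B.
    (* The reference point is independent of n; index 1 is the first at which a minimizer is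
       assumed. *)
    pose t1 := theta_opt 1; have Tt1 : Theta t1 := (theta_optP 1 (ltn0Sn 0)).1.
    have [Cr Cr0 regC] := convex_function_ge t1 reg_convex.
    have z0 : 0 <= zeta := le_trans (norm2_ge0 _) (ell_grad _ (D 1 ord0) Tt1).
    exists (4 / rho * (zeta + Cr) + norm2 t1) => [|n n0].
      by rewrite addr_ge0 ?norm2_ge0 ?mulr_ge0 ?invr_ge0 ?(ltW rho0)// addr_ge0.
    rewrite -{1}(subrK t1 (theta_opt n)) (le_trans (norm2D _ _))// lerD2r.
    have sL := L_strong n n0; have oL := theta_optP n n0; rewrite LE in sL oL.
    apply: (argmin_bounded n0 (w_simplex _ (D n) n0) Theta_convex rho0 sL oL
      Tt1 z0 Cr0) => [x|].
      (* The tangent inequality at [t1] involves only the gradient at [t1], bounded by zeta. *)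
      have [ell_diff _ _] := ell_C2 x.
      have := convex_gradient_le (theta_opt n) (ell_convex x) (ell_diff t1).
      have := le_trans (ler_norm _)
        (normr_dotv_le (- gradient (ell ^~ x) t1) (theta_opt n - t1)).
      rewrite norm2N dotvC dotvNr dotvC.
      have := ler_wpM2r (norm2_ge0 (theta_opt n - t1)) (ell_grad _ x Tt1); lra.
    exact: regC.
  (* G B comes from |gamma| |theta_opt| and M S from |b| / n, both over sqrt n. *)
  pose Q M := G * B + M * S.
  have key M : 0 <= M -> \forall n \near \oo, forall v : 'rV[R]_p, norm2 v <= M * s n ->
      norm2 (theta_priv n v - theta_opt n) <= 8 / rho * Q M / Num.sqrt n%:R /\
      L n (theta_priv n v) - L n (theta_opt n) <= 16 / rho * Q M ^+ 2 / n%:R.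
    move=> M0; near=> n => v vM.
    have n0 : (0 < n)%N by near: n; exact: nbhs_infty_gt.
    have q0 : 0 < Num.sqrt n%:R :> R by rewrite sqrtr_gt0 ltr0n.
    have nq : n%:R = Num.sqrt n%:R ^+ 2 :> R by rewrite sqr_sqrtr.
    have gn : `|gamma n| <= G / Num.sqrt n%:R by near: n.
    have vn : norm2 v / n%:R <= M * S / Num.sqrt n%:R.
      by move: v vM; near: n; exact: noise_le.
    (* Holds as soon as n >= (4 G / rho)^2. *)
    have grho : `|gamma n| <= rho / 4.
      rewrite (le_trans gn)// ler_pdivrMr// mulrC -ler_pdivrMr ?divr_gt0//.
      rewrite -[leLHS]ger0_norm; last by rewrite divr_ge0// divr_ge0// ltW.
      rewrite -sqrtr_sqr ler_wsqrtr//; near: n; exact: nbhs_infty_ger.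
    have sL := L_strong n n0; have oL := theta_optP n n0; have pL := theta_privP n v n0.
    rewrite !LE in sL oL *.
    have [] := private_excess_strong oL.1 pL Theta_convex rho0 sL oL grho.
    set e := `|gamma n| * _ + _ => te ee.
    have e0 : 0 <= e.
      by rewrite addr_ge0 ?mulr_ge0 ?norm2_ge0// divr_ge0 ?norm2_ge0.
    have eQ : e <= Q M / Num.sqrt n%:R.
      rewrite /Q mulrDl lerD// mulrAC ler_pM ?norm2_ge0//; exact: optB.
    split.
      by rewrite (le_trans te)// -[leRHS]mulrA ler_wpM2l// divr_ge0// ltW.
    rewrite (le_trans ee)// -[leRHS]mulrA ler_wpM2l ?divr_ge0 ?(ltW rho0)//.
    by rewrite [in leRHS]nq -expr_div_n ler_sqr ?nnegrE// (le_trans e0).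
  split.
    apply: (@stochastic_O_noise _ _ _ _ _ b s _
      (fun n v => L n (theta_priv n v) - L n (theta_opt n)) s_tail) => M M0.
    exists (16 / rho * Q M ^+ 2).
    apply: filterS2 (key M M0) (nbhs_infty_gt 0) => n kn n0 v vM.
    by rewrite ger0_norm ?excess_ge0//; exact: (kn v vM).2.
  apply: (@stochastic_O_noise _ _ _ _ _ b s _
    (fun n v => norm2 (theta_priv n v - theta_opt n)) s_tail) => M M0.
  exists (8 / rho * Q M); apply: filterS (key M M0) => n kn v vM.
  by rewrite ger0_norm ?norm2_ge0//; exact: (kn v vM).1.
apply: (@stochastic_O_noise _ _ _ _ _ b s _
  (fun n v => L n (theta_priv n v) - L n (theta_opt n)) s_tail) => M M0.
(* Case rho = 0: the summands bound, in order, the three terms of [private_excess_le]. *)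
exists (G / 2 * B ^+ 2 + M * S * B + M ^+ 2 * K * (C + 1) * (3 * epsilon / (4 * lambda))).
have [A A0 gammaA] := gamma_calibrated.
near=> n => v vM.
have n0 : (0 < n)%N by near: n; exact: nbhs_infty_gt.
have nR : 0 < n%:R :> R by rewrite ltr0n.
have q0 : 0 < Num.sqrt n%:R :> R by rewrite sqrtr_gt0 ltr0n.
have q1 : 1 <= Num.sqrt n%:R :> R by rewrite -[leLHS]sqrtr1 ler_wsqrtr// ler1n.
have nq : n%:R = Num.sqrt n%:R ^+ 2 :> R by rewrite sqr_sqrtr.
have gn : `|gamma n| <= G / Num.sqrt n%:R by near: n.
have vn : norm2 v / n%:R <= M * S / Num.sqrt n%:R.
  by move: v vM; near: n; exact: noise_le.
have g0 : 0 < gamma n by near: n.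
have oB : norm2 (theta_opt n) <= B by near: n.
have B0 : 0 <= B := le_trans (norm2_ge0 _) oB.
have sn : s n ^+ 2 <= K * (r1 n ^+ 2 + r1 n) by near: n.
have [/andP[r10 r1q] /andP[r20 _] r12] : [/\ 0 <= r1 n <= C * Num.sqrt n%:R,
  0 <= r2 n <= C * Num.sqrt n%:R & r1 n <= 3 * r2 n] by near: n.
have /andP[lg gl] : 2 * lambda / (epsilon * n%:R) * r2 n <= gamma n <=
  A * (2 * lambda / (epsilon * n%:R) * r2 n) by near: n.
(* A positive gamma lies below a positive multiple of lambda r2 with r2 >= 0, which forces lambda >
   0. *)
have lambda0 : 0 < lambda.
  have := lt_le_trans g0 gl; rewrite pmulr_rgt0// => h.
  rewrite ltNge; apply/negP => l0; move: h; rewrite ltNge => /negP; apply.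
  by rewrite mulr_le0_ge0// pmulr_lle0 ?invr_gt0 ?mulr_gt0// pmulr_rle0.
rewrite ger0_norm ?excess_ge0//.
have oL := theta_optP n n0; have pL := theta_privP n v n0.
rewrite !LE in oL *.
apply: (le_trans (private_excess_le oL.1 pL g0)).
rewrite [leRHS]mulrDl; apply: lerD; first (rewrite [leRHS]mulrDl; apply: lerD).
- rewrite (mulrAC _ _ (_^-1)) [X in _ <= X * _]mulrAC.
  apply: ler_pM; rewrite ?sqr_ge0 ?divr_ge0 ?(ltW g0)//.
    by rewrite ler_wpM2r// -[gamma n]gtr0_norm.
  by rewrite ler_sqr ?nnegrE ?norm2_ge0.
- rewrite [leRHS]mulrAC; apply: ler_pM => //; last exact: norm2_ge0.
  by rewrite divr_ge0 ?norm2_ge0.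
have := @noise_over_gamma_le _ (norm2 v) M (s n) K (r1 n) (r2 n) (gamma n) lambda
  epsilon C (Num.sqrt n%:R); rewrite -nq; apply => //.
- exact: norm2_ge0.
- exact: ltW.
- by rewrite r10.
Unshelve. all: end_near. Qed.
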